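(* Let $C$ be a projective line $\mathbb{P}^1_{\mathbb{C}}$ linearly embedded in $\mathrm{Fol}(k)$. For $d\in\mathbb{N}$ let $\pi_C(d)\in\mathbb{N}\cup\{+\infty\}$ be the number of points of $C$ representing a foliation with a rational first integral of degree at most $d$. If $\pi_C(d)<\infty$ for every $d\in\mathbb{N}$, then there exists a constant $K$ such that $$\pi_C(d)\le K d^4\qquad\text{for every } d\in\mathbb{N}.$$
   Context: $\mathrm{Fol}(k)$ is the space of foliations of degree $k$ on $\mathbb{P}^2_{\mathbb{C}}$: the projectivization of the vector space of vector fields on $\mathbb{C}^3$ with homogeneous polynomial coefficients of degree $k$, modulo multiples of the radial field $R=x\frac{\partial}{\partial x}+y\frac{\partial}{\partial y}+z\frac{\partial}{\partial z}$. A linearly embedded projective line consists of the classes of $sX+tY$, $(s:t)\in\mathbb{P}^1_{\mathbb{C}}$, where $X,Y$ represent two distinct points of $\mathrm{Fol}(k)$. A rational first integral of degree $e$ of the foliation represented by $X$ is a non-constant rational function $P/Q$, with $P,Q$ coprime homogeneous polynomials in $x,y,z$ of degree $e$, such that $X(P/Q)=0$. *)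

(* Defs.v *)
(* C is rendered as R[i] (type complex R) for an arbitrary R : realType. *)
From HB Require Import structures.
From mathcomp Require Import all_boot all_order all_algebra.
From mathcomp Require Import generic_quotient fraction complex mpoly ring.
From mathcomp Require Import boolp classical_sets cardinality.
From mathcomp Require Import reals constructive_ereal.
(* Not imported: the notations of its dependencies clash with those of mpoly. *)
From mathcomp Require counting_measure.

Set Implicit Arguments.
Unset Strict Implicit.
Unset Printing Implicit Defensive.

Import GRing.Theory.

Local Open Scope ring_scope.
Local Open Scope classical_set_scope.

#[local] Notation "x %:F" := (tofrac x).

(* C[x, y, z], with x, y, z = 'X_0, 'X_1, 'X_2, and C(x, y, z). *)
Notation polyC3 R := {mpoly (complex R)[3]}.
Notation ratC3 R := {fraction polyC3 R}.

(* The row (A, B, C) encodes the vector field A d/dx + B d/dy + C d/dz. *)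
Notation vfield R := 'rV[polyC3 R]_3.

Definition vf_homog (R : realType) (k : nat) (X : vfield R) : Prop :=
  forall i, X 0 i \is k.-homog.

Definition radial (R : realType) : vfield R := \row_i 'X_i.

(* For X homogeneous of degree k the factor g is automatically homogeneous of
   degree k - 1 (and g = 0 if k = 0). *)
Definition radial_multiple (R : realType) (X : vfield R) : Prop :=
  exists g : polyC3 R, X = g *: radial R.

Definition vf_lin (R : realType) (s t : complex R) (X Y : vfield R) :
    vfield R :=
  s%:MP *: X + t%:MP *: Y.

(* The point of Fol(k) represented by X, as the set of all its homogeneous
   representatives. *)
Definition fol_class (R : realType) (k : nat) (X : vfield R) :
    set (vfield R) :=
  [set Z | vf_homog k Z /\
     exists c : complex R, c != 0 /\ radial_multiple (Z - c%:MP *: X)].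

Definition Fol (R : realType) (k : nat) : set (set (vfield R)) :=
  [set p | exists X : vfield R,
     [/\ vf_homog k X, ~ radial_multiple X & p = fol_class k X]].

Definition projective_line (R : realType) (k : nat)
    (C : set (set (vfield R))) : Prop :=
  exists X Y : vfield R,
    [/\ vf_homog k X /\ vf_homog k Y,
        Fol k (fol_class k X) /\ Fol k (fol_class k Y),
        fol_class k X <> fol_class k Y &
        C = [set p | exists s t : complex R,
               (s, t) != (0, 0) /\ p = fol_class k (vf_lin s t X Y)]].

Definition vf_poly (R : realType) (X : vfield R) (P : polyC3 R) : polyC3 R :=
  \sum_(i < 3) X 0 i * P^`M(i).

(* X as a derivation of C(x, y, z), by the quotient rule applied to a chosen
   numerator and denominator; vf_rat_div shows that the choice is irrelevant. *)
Definition vf_rat (R : realType) (X : vfield R) (f : ratC3 R) : ratC3 R :=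
  let n := \n_(repr f) in
  let d := \d_(repr f) in
  (vf_poly X n * d - n * vf_poly X d)%:F / (d ^+ 2)%:F.

Definition mcoprime (R : realType) (P Q : polyC3 R) : Prop :=
  forall D A B : polyC3 R, P = D * A -> Q = D * B -> D \is a GRing.unit.

Definition rat_first_integral (R : realType) (X : vfield R) (e : nat) : Prop :=
  exists P Q : polyC3 R,
    [/\ P \is e.-homog /\ Q \is e.-homog,
        Q != 0 /\ mcoprime P Q,
        ~ (exists c : complex R, P%:F / Q%:F = (c%:MP)%:F :> ratC3 R) &
        vf_rat X (P%:F / Q%:F) = 0].

(* By Euler's identity the radial field kills P / Q when P and Q are homogeneous
   of the same degree, so all representatives of p have the same rational first
   integrals. *)
Definition algebraic_points (R : realType) (C : set (set (vfield R)))
    (d : nat) : set (set (vfield R)) :=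
  [set p | C p /\ exists X : vfield R,
     p X /\ exists e : nat, (e <= d)%N /\ rat_first_integral X e].

Definition pi_line (R : realType) (C : set (set (vfield R))) (d : nat) :
    \bar R :=
  counting_measure.counting (algebraic_points C d).

Lemma vf_polyM (R : realType) (X : vfield R) (P Q : polyC3 R) :
  vf_poly X (P * Q) = vf_poly X P * Q + P * vf_poly X Q.
Proof.
rewrite /vf_poly mulr_suml mulr_sumr -big_split /=; apply: eq_bigr => i _.
by rewrite mderivM mulrDr !mulrA (mulrC P).
Qed.

Lemma tofrac_eqdiv (A : idomainType) (a b c d : A) :
  b != 0 -> d != 0 -> a * d = c * b -> a%:F / b%:F = c%:F / d%:F.
Proof.
move=> b0 d0 E; apply: (canRL (mulfK _)); first by rewrite tofrac_eq0.
rewrite mulrAC; apply: (canLR (mulfK _)); first by rewrite tofrac_eq0.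
by rewrite -!tofracM E.
Qed.

Lemma quotient_ruleE (A : comPzRingType) (n d P Q n' d' P' Q' : A) :
  n * Q = P * d -> n' * Q + n * Q' = P' * d + P * d' ->
  (n' * d - n * d') * Q ^+ 2 = (P' * Q - P * Q') * d ^+ 2.
Proof.
move=> E DE.
have -> : (n' * d - n * d') * Q ^+ 2
    = d * Q * (n' * Q + n * Q') - n * Q * (d * Q' + d' * Q) by ring.
by rewrite DE E; ring.
Qed.

Lemma numden_repr (R : realType) (f : ratC3 R) :
  f * (\d_(repr f))%:F = (\n_(repr f))%:F.
Proof.
elim/quotW: f => x; set y := repr _.
have /eqP : \n_x * \d_y = \d_x * \n_y.
  by apply/eqP; rewrite -FracField.equivf_def reprK.
have dx0 : \d_x != 0 := denom_ratioP x.
move=> /eqP E; unlock tofrac.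
rewrite -[LHS]FracField.pi_mul; apply/eqmodP => /=.
rewrite FracField.equivfE /FracField.mulf !numden_Ratio ?mulr1 ?oner_eq0 //.
by rewrite E.
Qed.

Lemma vf_rat_div (R : realType) (X : vfield R) (P Q : polyC3 R) :
  Q != 0 ->
  vf_rat X (P%:F / Q%:F) =
    (vf_poly X P * Q - P * vf_poly X Q)%:F / (Q ^+ 2)%:F.
Proof.
move=> Q0; rewrite /vf_rat; have := numden_repr (P%:F / Q%:F).
set n := \n_ _; set d := \d_ _ => E.
have d0 : d != 0 := denom_ratioP _.
have Q0' : Q%:F != 0 by rewrite tofrac_eq0.
have {}E : n * Q = P * d.
  by apply/eqP; rewrite -tofrac_eq !tofracM -E mulrAC divfK.
have DE := congr1 (vf_poly X) E; rewrite !vf_polyM in DE.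
apply: tofrac_eqdiv; [exact: expf_neq0 | exact: expf_neq0 |].
exact: quotient_ruleE E DE.
Qed.

(* Main.v *)
Require Import Defs.
From mathcomp Require Import all_boot all_order all_algebra.
From mathcomp Require Import complex mpoly classical_sets reals constructive_ereal.
From mathcomp Require Import perm ring fraction boolp cardinality finmap.
From mathcomp Require counting_measure.

(** The argument compares the foliations of the line with the zeros of a
    Wronskian, the determinant of Pereira's extactic curve.

    Fix d, and let v_j, j < N = (d+1)^2, be the monomials x^a y^b z^(2d-a-b)
    with a, b <= d. For a homogeneous vector field X let W(X) be the determinant
    of the matrix (X^i v_j) with i, j < N. Two facts link W to first integrals.

    - If X has a rational first integral P/Q of degree e <= d, then W(X) = 0:
      P z^(2d-e) and Q z^(2d-e) are constant combinations of the v_j, and their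
      quotient P/Q is a constant of X, so the columns of the matrix are
      dependent over the fraction field
      ([first_integral_wronskian_eq0]).
    - If W(X) = 0, then X has a rational first integral of degree bounded in
      terms of d and k alone: a minimal relation between the v_j has
      coefficients that are minors of the matrix, homogeneous of the same
      degree, and whose quotients are constants of X; as distinct monomials are
      independent over C, one quotient is not a complex number
      ([wronskian_eq0_first_integral], [coprime_first_integral]). This bound is
      far worse than d, but it is only used qualitatively.

    Since X |-> X^i v_j is polynomial of degree i in X, the function
    c |-> W(X + cY) on a pencil is a polynomial in c of degree less than N^2
    ([wronskian_pencil_horner]). It is not zero: otherwise every point of the
    line, and there are infinitely many, would have a first integral of the
    same bounded degree, against the finiteness assumption. So at most N^2 - 1
    of the points X + cY, and possibly the point Y, have a first integral of
    degree at most d, and N^2 = (d+1)^4 <= 16 d^4 for d > 0. For d = 0 there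
    are no such points, as first integrals are not constant. *)

Set Implicit Arguments.
Unset Strict Implicit.
Unset Printing Implicit Defensive.

Import Order.TTheory GRing.Theory Num.Theory.

Local Open Scope ring_scope.

(** * Wronskians of a derivation on a domain *)

Section Wronskian.

Variables (A : idomainType) (delta : A -> A).
Hypothesis deltaD : {morph delta : a b / a + b}.
Hypothesis deltaM : forall a b, delta (a * b) = delta a * b + a * delta b.

Lemma delta0 : delta 0 = 0.
Proof. by apply: (addrI (delta 0)); rewrite -deltaD !addr0. Qed.

Lemma delta_sum (I : finType) (F : I -> A) :
  delta (\sum_i F i) = \sum_i delta (F i).
Proof. exact: (big_morph delta deltaD delta0). Qed.

Definition wronskian_mx (v : nat -> A) n : 'M[A]_n :=
  \matrix_(i, j) iter i delta (v j).

Definition wronskian v n := \det (wronskian_mx v n).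

Lemma wronskian_mx_ord_max (v : nat -> A) r :
  row' ord_max (col' ord_max (wronskian_mx v r.+1)) = wronskian_mx v r.
Proof. by apply/matrixP => i j; rewrite !mxE !lift_max. Qed.

Lemma det_neq0_mul_inj n (M : 'M[A]_n) (x : 'cV[A]_n) :
  \det M != 0 -> M *m x = 0 -> x = 0.
Proof.
move=> M0 /(congr1 (mulmx (\adj M))); rewrite mulmx0 mulmxA mul_adj_mx.
rewrite mul_scalar_mx => /matrixP E; apply/matrixP => i j.
by have /eqP := E i j; rewrite !mxE mulf_eq0 (negPf M0) => /eqP.
Qed.

(** Dependence over the constants of a derivation, without fractions. Among the
    initial Wronskians take the first zero one, of size r + 1; the cofactors
    c_l of its last row satisfy the r + 1 relations sum_l c_l delta^i v_l = 0.
    Differentiating the first r of them shows that the delta c_l satisfy these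
    r relations too. Hence so do c_max delta c_l - c_l delta c_max, whose last
    term vanishes, and the nonzero minor c_max of size r forces them all to be
    zero. Naming the c_l as cofactors is what makes their degrees computable. *)
Lemma wronskian_eq0_first_integrals (v : nat -> A) n :
  wronskian v n = 0 ->
  exists r (c : 'I_r.+1 -> A),
    [/\ (r < n)%N, forall l, c l = cofactor (wronskian_mx v r.+1) ord_max l,
        c ord_max != 0, \sum_l c l * v l = 0 &
        forall l, delta (c l) * c ord_max = c l * delta (c ord_max)].
Proof.
move=> Wn0; have exW : exists m, wronskian v m == 0 by exists n; apply/eqP.
case: (ex_minnP exW) => -[|r] /eqP Wr0 minr.
  by have /eqP := Wr0; rewrite /wronskian det_mx00 oner_eq0.
have Wr : wronskian v r != 0.
  by apply/negP => /minr; rewrite ltnn.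
pose c l := cofactor (wronskian_mx v r.+1) ord_max l; exists r, c.
have cmaxE : c ord_max = wronskian v r.
  by rewrite /c /cofactor wronskian_mx_ord_max addnn -signr_odd odd_double mul1r.
have rel (i : 'I_r.+1) : \sum_l c l * iter i delta (v l) = 0.
  have /matrixP /(_ i ord_max) := mul_mx_adj (wronskian_mx v r.+1).
  rewrite -/(wronskian v r.+1) Wr0 mxE [RHS]mxE mul0rn => E.
  by rewrite -[RHS]E; apply: eq_bigr => l _; rewrite !mxE mulrC.
split=> //; first by apply: minr; rewrite Wn0.
- by rewrite cmaxE.
- exact: (rel ord0).
(* The term with delta^i.+1 v_l is again one of the r + 1 relations. *)
have drel (i : 'I_r) : \sum_l delta (c l) * iter i delta (v l) = 0.
  have /(congr1 delta) := rel (widen_ord (leqnSn r) i).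
  rewrite delta0 delta_sum; under eq_bigr do rewrite deltaM.
  rewrite big_split /=.
  by have /= -> := rel (lift ord0 i); rewrite addr0.
pose u l := delta (c l) * c ord_max - c l * delta (c ord_max).
have urel (i : 'I_r) : \sum_l u l * iter i delta (v l) = 0.
  rewrite (eq_bigr (fun l => c ord_max * (delta (c l) * iter i delta (v l))
    - delta (c ord_max) * (c l * iter i delta (v l)))); last first.
    by move=> l _; rewrite /u; ring.
  rewrite sumrB -!mulr_sumr drel.
  by have /= -> := rel (widen_ord (leqnSn r) i); rewrite !mulr0 subrr.
have umax : u ord_max = 0 by rewrite /u mulrC subrr.
have u0 : \col_(l < r) u (widen_ord (leqnSn r) l) = 0.
  apply: (det_neq0_mul_inj Wr); apply/matrixP => i j; rewrite !mxE.
  have := urel i; rewrite big_ord_recr /= umax mul0r addr0; apply: etrans.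
  by apply: eq_bigr => l _; rewrite !mxE mulrC.
move=> l; apply/eqP; rewrite -subr_eq0 -/(u l).
case: (unliftP ord_max l) => [l'|] ->; last by rewrite /u mulrC subrr.
move/matrixP/(_ l' 0): u0; rewrite !mxE => <-; apply/eqP; congr u.
by apply: val_inj; rewrite /= /bump leqNgt ltn_ord.
Qed.

(** If p / q is a constant of delta and p / q = u / w, then q delta^i u = p
    delta^i w for all i. For u and w constant combinations of the v_j, this
    makes (q a_j - p b_j) a kernel vector of the Wronskian matrix. *)
Lemma wronskian_neq0_proportional (v : nat -> A) n (a b : 'I_n -> A) p q :
  (forall j, delta (a j) = 0) -> (forall j, delta (b j) = 0) ->
  q != 0 -> delta p * q = p * delta q ->
  q * (\sum_j a j * v j) = p * (\sum_j b j * v j) ->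
  wronskian v n != 0 -> forall j, q * a j = p * b j.
Proof.
move=> a0 b0 q0 Dpq; set u := \sum_j _; set w := \sum_j _ => quw W.
have iterE e : (forall j : 'I_n, delta (e j) = 0) -> forall i,
    iter i delta (\sum_j e j * v j) = \sum_j e j * iter i delta (v j).
  move=> e0; elim=> [|i IH] //=; rewrite IH delta_sum; apply: eq_bigr => j _.
  by rewrite deltaM e0 mul0r add0r.
have quwi i : q * iter i delta u = p * iter i delta w.
  elim: i => [|i IH] //=; have := congr1 delta IH; rewrite !deltaM => IH'.
  apply: (mulfI q0); apply: (addrI (q * (delta q * iter i delta u))).
  rewrite -mulrDr IH'.
  have -> : q * (delta q * iter i delta u) = delta p * q * iter i delta w.
    by rewrite Dpq mulrCA IH; ring.
  by ring.
suff : \col_j (q * a j - p * b j) = 0.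
  by move=> /matrixP E j; have := E j 0; rewrite !mxE => /subr0_eq.
apply: (det_neq0_mul_inj W); apply/matrixP => i k; rewrite !mxE.
rewrite (eq_bigr (fun j => q * (a j * iter i delta (v j))
   - p * (b j * iter i delta (v j)))); last by move=> j _; rewrite !mxE; ring.
by rewrite sumrB -!mulr_sumr -!iterE // quwi subrr.
Qed.

End Wronskian.

(** * Homogeneity of vector fields, minors and cofactors *)

Lemma vf_polyC (R : realType) (X : vfield R) c : vf_poly X c%:MP = 0.
Proof. by rewrite /vf_poly big1 // => i _; rewrite mderivC mulr0. Qed.

Lemma vf_polyD (R : realType) (X : vfield R) :
  {morph vf_poly X : p q / p + q}.
Proof.
move=> p q; rewrite /vf_poly -big_split; apply: eq_bigr => i _.
by rewrite mderivD mulrDr.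
Qed.

Lemma vf_poly_sum (R : realType) (X : vfield R) (I : Type) (r : seq I)
    (F : I -> polyC3 R) :
  vf_poly X (\sum_(i <- r) F i) = \sum_(i <- r) vf_poly X (F i).
Proof. exact: (big_morph _ (vf_polyD X) (vf_polyC X 0)). Qed.

Lemma vf_polyDl (R : realType) (X Y : vfield R) p :
  vf_poly (X + Y) p = vf_poly X p + vf_poly Y p.
Proof.
by rewrite /vf_poly -big_split; apply: eq_bigr => i _; rewrite mxE mulrDl.
Qed.

Lemma vf_polyZl (R : realType) (g : polyC3 R) (X : vfield R) p :
  vf_poly (g *: X) p = g * vf_poly X p.
Proof.
by rewrite /vf_poly mulr_sumr; apply: eq_bigr => i _; rewrite mxE mulrA.
Qed.

(** Euler's identity. *)
Lemma vf_poly_radial (R : realType) n (p : polyC3 R) :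
  p \is n.-homog -> vf_poly (radial R) p = n%:R * p.
Proof.
move=> hp; rewrite [in LHS](mpolyE p) vf_poly_sum [in RHS](mpolyE p) mulr_sumr.
apply: eq_big_seq => m /(dhomog_mf hp) /= <-; rewrite /vf_poly mdegE.
rewrite mulr_natl -sumrMnr; apply: eq_bigr => i _.
rewrite mxE mderivZ mderivX scaler_nat -scalerMnr mulrnAr.
have [->|mi] := eqVneq (m i) 0%N; first by rewrite !mulr0n.
by rewrite -scalerAr -mpolyXD addmC submK // lep1mP.
Qed.

Lemma mderiv_homog n (K : nzRingType) k (p : {mpoly K[n]}) i :
  p \is k.-homog -> p^`M(i) \is k.-1.-homog.
Proof.
move=> hp; apply/dhomogP => m; rewrite mcoeff_msupp mcoeff_deriv => /=.
move=> E; have : (m + U_(i))%MM \in msupp p.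
  by rewrite mcoeff_msupp; apply: contra_neq E => ->; rewrite mul0rn.
by move=> /(dhomog_mf hp) /=; rewrite mdegD mdeg1 addn1 => <-.
Qed.

(** The truncated predecessor is harmless: when n + k = 0, the polynomial is
    constant and its image is zero, which is homogeneous of every degree. *)
Lemma vf_poly_homog (R : realType) k n (X : vfield R) p :
  vf_homog k X -> p \is n.-homog -> vf_poly X p \is (n + k).-1.-homog.
Proof.
move=> hX hp; have [n0|n_gt0] := posnP n.
  have -> : p = (p@_0)%:MP.
    apply: msize1_polyC; rewrite msizeE.
    apply/bigmax_leqP_seq => m /(dhomog_mf hp) /=; rewrite n0 => -> //.
  by rewrite vf_polyC dhomog0.
apply: rpred_sum => i _; have -> : (n + k).-1 = (k + n.-1)%N.
  by rewrite addnC -subn1 -addnBA // subn1.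
by apply: dhomogM; [exact: hX | exact: mderiv_homog].
Qed.

Lemma iter_vf_poly_homog (R : realType) k n (X : vfield R) p i :
  vf_homog k X -> p \is n.-homog ->
  iter i (vf_poly X) p \is (iter i (fun m => (m + k).-1) n).-homog.
Proof. by move=> hX hp; elim: i => //= i IH; exact: vf_poly_homog. Qed.

Lemma det_homog n (K : comNzRingType) m (M : 'M[{mpoly K[n]}]_m)
    (g : 'I_m -> nat) :
  (forall i j, M i j \is (g i).-homog) -> \det M \is (\sum_i g i).-homog.
Proof.
move=> hM; apply: rpred_sum => s _.
have [b ->] : exists b : bool, (-1) ^+ (s) = (-1) ^+ b :> {mpoly K[n]}.
  by eexists.
rewrite mulr_sign; have h : \prod_i M i (s i) \is (\sum_i g i).-homog.
  apply: (big_ind2 (fun p k => p \is k.-homog)) => //; first exact: dhomog1.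
  by move=> p k q l hp hq; exact: dhomogM.
by case: b; rewrite ?rpredN.
Qed.

Lemma cofactor_ord_max_homog n (K : comNzRingType) r (M : 'M[{mpoly K[n]}]_r.+1)
    (g : nat -> nat) l :
  (forall i j, M i j \is (g i).-homog) ->
  cofactor M ord_max l \is (\sum_(i < r) g i).-homog.
Proof.
move=> hM; rewrite /cofactor -signr_odd mulr_sign.
have h : \det (row' ord_max (col' l M)) \is (\sum_(i < r) g i).-homog.
  by apply: det_homog => i j; have := hM (lift ord_max i) (lift l j);
    rewrite !mxE lift_max.
by case: (odd _); rewrite ?rpredN.
Qed.

(** * First integrals and the vanishing of the Wronskian *)

(** The exponent of x^a y^b z^(2d-a-b), where j = a (d + 1) + b. The degree 2d
    leaves room for a and b to range independently over {0, ..., d}, which makes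
    the family easy to number while keeping its size quadratic in d. *)
Definition grid_mon (d j : nat) : 'X_{1..3} :=
  let a := (j %/ d.+1)%N in let b := (j %% d.+1)%N in
  [multinom nth 0%N [:: a; b; (d.*2 - (a + b))%N] i | i < 3].

Lemma grid_mon_inj d : injective (grid_mon d).
Proof.
move=> i j /mnmP E; have := E (@Ordinal 3 0 isT); have := E (@Ordinal 3 1 isT).
rewrite !mnmE /= => E1 E0.
by rewrite (divn_eq i d.+1) (divn_eq j d.+1) E0 E1.
Qed.

Lemma mdeg_grid_mon d j : (j < d.+1 ^ 2)%N -> mdeg (grid_mon d j) = d.*2.
Proof.
move=> jN; rewrite mdegE !big_ord_recl big_ord0 !mnmE /= addn0 addnA subnKC //.
rewrite -addnn leq_add //; last by rewrite -ltnS ltn_mod.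
by rewrite -ltnS ltn_divLR // mulnn.
Qed.

Lemma grid_mon_surj d (m : 'X_{1..3}) :
  mdeg m = d.*2 -> (forall i : 'I_3, (i < 2)%N -> (m i <= d)%N) ->
  exists2 j, (j < d.+1 ^ 2)%N & grid_mon d j = m.
Proof.
move=> dm hm; set a := m (@Ordinal 3 0 isT); set b := m (@Ordinal 3 1 isT).
have [ad bd] : (a < d.+1)%N /\ (b < d.+1)%N by rewrite !ltnS !hm.
exists (a * d.+1 + b)%N.
  by rewrite -mulnn -ltn_divLR // divnMDl // divn_small // addn0.
apply/mnmP => -[[|[|[|//]]] lti]; rewrite mnmE /=.
- by rewrite divnMDl // divn_small // addn0; congr (m _); exact: val_inj.
- by rewrite modnMDl modn_small //; congr (m _); exact: val_inj.
have -> : d.*2 = (a + b + m (Ordinal lti))%N.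
  rewrite -dm mdegE !big_ord_recl big_ord0 addn0 addnA.
  by congr (m _ + m _ + m _)%N; exact: val_inj.
by rewrite divnMDl // divn_small // addn0 modnMDl modn_small // addKn.
Qed.

Section Grid.

Variable K : nzRingType.

Definition grid d (j : nat) : {mpoly K[3]} := 'X_[grid_mon d j].

Lemma mcoeff_grid_sum d n (a : 'I_n -> K) (l : 'I_n) :
  (\sum_j (a j)%:MP * grid d j)@_(grid_mon d l) = a l.
Proof.
rewrite raddf_sum (bigD1 l) //= mcoeffCM mcoeffX eqxx mulr1 big1 ?addr0 //.
move=> j jl; rewrite mcoeffCM mcoeffX (inj_eq (@grid_mon_inj d)).
by rewrite (inj_eq val_inj) (negPf jl) mulr0.
Qed.

(** A monomial of degree e <= d has exponents at most d in x and y, so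
    multiplying it by the right power of z yields a member of the grid. *)
Lemma grid_spans d e (p : {mpoly K[3]}) : (e <= d)%N -> p \is e.-homog ->
  exists a : 'I_(d.+1 ^ 2) -> K,
    p * 'X_ord_max ^+ (d.*2 - e) = \sum_j (a j)%:MP * grid d j.
Proof.
move=> ed hp; set u := p * _; exists (fun j => u@_(grid_mon d j)).
apply/mpolyP => m; have [mu|mu] := boolP (m \in msupp u).
  have [j jN <-] : exists2 j, (j < d.+1 ^ 2)%N & grid_mon d j = m.
    have ud : d.*2 = (e + (d.*2 - e))%N.
      by rewrite subnKC // -addnn (leq_trans ed) // leq_addr.
    apply: grid_mon_surj.
      have hu : u \is d.*2.-homog.
        rewrite ud; apply: dhomogM => //; rewrite -[X in X.-homog]mul1n.
        by apply: dhomogMn; rewrite dhomogX /= mdeg1.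
      exact: (dhomog_mf hu mu).
    move=> i i2; move: mu; rewrite /u mpolyXn.
    rewrite (perm_mem (msuppMX _ _)) => /mapP [m' m'p ->].
    have im : (ord_max == i) = false by rewrite -val_eqE /= gtn_eqF.
    rewrite mnmDE mulmnE mnm1E im mul0n add0n (leq_trans _ ed) // -(dhomog_mf hp m'p) /= mdegE.
    by rewrite (bigD1 i) //= leq_addr.
  by rewrite (mcoeff_grid_sum d (fun j => u@_(grid_mon d j)) (Ordinal jN)).
move: mu; rewrite -mcoeff_eq0 => /eqP um; rewrite um raddf_sum big1 //= => j _.
rewrite mcoeffCM mcoeffX; case: eqP => [E|]; last by rewrite mulr0.
by rewrite E um mul0r.
Qed.

End Grid.

Definition proportional (R : realType) (p q : polyC3 R) :=
  exists c : complex R, p = c%:MP * q.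

(** With a and b the coordinates in the grid of p and q, each multiplied by the
    same power of z, a nonzero Wronskian would give q a_j = p b_j for all j; as
    some b_j is nonzero, p would be a constant multiple of q. *)
Lemma first_integral_wronskian_eq0 (R : realType) (X : vfield R) d e
    (p q : polyC3 R) :
  (e <= d)%N -> p \is e.-homog -> q \is e.-homog -> q != 0 ->
  ~ proportional p q -> vf_poly X p * q = p * vf_poly X q ->
  wronskian (vf_poly X) (grid (complex R) d) (d.+1 ^ 2) = 0.
Proof.
move=> ed hp hq q0 npq Dpq; apply/eqP; apply: contra_notT npq => W.
have [a pa] := grid_spans ed hp; have [b qb] := grid_spans ed hq.
have E : forall j, q * (a j)%:MP = p * (b j)%:MP.
  apply: (wronskian_neq0_proportional (delta := vf_poly X) _ _ _ _ q0 Dpq _ W).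
  - exact: vf_polyD.
  - exact: vf_polyM.
  - by move=> j; rewrite /= vf_polyC.
  - by move=> j; rewrite /= vf_polyC.
  - by rewrite -pa -qb mulrCA.
have [j bj] : exists j, b j != 0.
  apply/existsP; apply: contraNT q0 => /existsPn b0.
  have : q * 'X_ord_max ^+ (d.*2 - e) == 0.
    by rewrite qb big1 // => j _; rewrite (eqP (negPn (b0 j))) mpolyC0 mul0r.
  by rewrite mulf_eq0 mpolyXn -!msize_poly_eq0 msizeX orbF.
exists ((b j)^-1 * a j); rewrite mpolyCM -mulrA [_ * q]mulrC E mulrCA -mpolyCM.
by rewrite mulVf // mulr1.
Qed.

(** The degree bound does not depend on X, so it is the same for all members of
    a pencil. If all quotients c_l / c_max were complex numbers, the relation
    sum_l c_l v_l = 0 would be a nontrivial C-linear relation between distinct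
    monomials. *)
Lemma wronskian_eq0_first_integral (R : realType) (X : vfield R) k d n :
  vf_homog k X ->
  wronskian (vf_poly X) (grid (complex R) d) n = 0 -> (n <= d.+1 ^ 2)%N ->
  exists e (p q : polyC3 R),
    [/\ (e <= \sum_(i < n) iter i (fun m => (m + k).-1) d.*2)%N,
        p \is e.-homog /\ q \is e.-homog, q != 0, ~ proportional p q &
        vf_poly X p * q = p * vf_poly X q].
Proof.
move=> hX W nd.
have [r [c [rn cE c0 rel Dc]]] := wronskian_eq0_first_integrals (vf_polyD X) (vf_polyM X) W.
exists (\sum_(i < r) iter i (fun m => (m + k).-1) d.*2).
have hc l : c l \is (\sum_(i < r) iter i (fun m => (m + k).-1) d.*2).-homog.
  rewrite cE; apply: cofactor_ord_max_homog => i j; rewrite mxE; apply: iter_vf_poly_homog => //.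
  rewrite dhomogX /= mdeg_grid_mon // (leq_trans _ nd) // (leq_trans _ rn) //.
have [l npl] : exists l, ~ proportional (c l) (c ord_max).
  apply: contrapT => /forallNP allp.
  have {}allp l : exists a : complex R, c l = a%:MP * c ord_max.
    exact: contrapT (allp l).
  have [a ca] := choice allp.
  have : c ord_max * (\sum_l (a l)%:MP * grid (complex R) d l) = 0.
    rewrite -[RHS]rel mulr_sumr; apply: eq_bigr => l _.
    by rewrite [in RHS]ca mulrCA mulrA.
  move/eqP; rewrite mulf_eq0 (negPf c0) /= => /eqP S0.
  have := mcoeff_grid_sum d a ord_max; rewrite S0 mcoeff0 => a0.
  by move: c0; rewrite ca -a0 mpolyC0 mul0r eqxx.
exists (c l), (c ord_max); split => //.
by rewrite -(subnKC (ltnW rn)) big_split_ord /= leq_addr.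
Qed.

(** * Rational first integrals in lowest terms *)

Section TopComponent.

Variables (n : nat) (K : idomainType).
Implicit Types p q : {mpoly K[n]}.

Definition top_component p := pihomog mdeg (msize p).-1 p.

Lemma mcoeff_pihomog d p m :
  (pihomog mdeg d p)@_m = if mdeg m == d then p@_m else 0.
Proof.
rewrite {1}pihomogE raddf_sum /=.
rewrite (eq_bigr (fun m' => p@_m' *+ (m' == m))); last first.
  by move=> m' _; rewrite mcoeffZ mcoeffX mulr_natr.
have [mp|mp] := boolP (m \in msupp p).
  rewrite big_mkcond (bigD1_seq m) //= eqxx big1 ?addr0 // => m' mm'.
  by rewrite (negPf mm') if_same.
rewrite big1_seq => [|m' /andP[_ m'p]].
  by move: mp; rewrite -mcoeff_eq0 => /eqP ->; rewrite if_same.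
by case: eqP m'p => // ->; rewrite (negPf mp).
Qed.

Lemma top_component_homog p : top_component p \is (msize p).-1.-homog.
Proof. exact: pihomogP. Qed.

Lemma msize_sub_top_component p : p != 0 -> (msize (p - top_component p)%R < msize p)%N.
Proof.
move=> p0; have sp : (0 < msize p)%N by rewrite lt0n msize_poly_eq0.
rewrite [X in (X < _)%N]msizeE -(prednK sp) ltnS; apply/bigmax_leqP_seq => m.
rewrite mcoeff_msupp mcoeffB mcoeff_pihomog => + _.
case: ifPn => [_|ne]; first by rewrite subrr eqxx.
rewrite subr0 -mcoeff_msupp => /msize_mdeg_lt; rewrite -{1}(prednK sp) ltnS.
by rewrite leq_eqVlt (negPf ne).
Qed.

Lemma homog_eq0 d p : p \is d.-homog -> (msize p <= d)%N -> p = 0.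
Proof.
move=> hp sp; apply/mpolyP => m; rewrite mcoeff0; apply/eqP.
rewrite mcoeff_eq0; apply/negP => mp; have := msize_mdeg_lt mp.
by rewrite (dhomog_mf hp mp) ltnNge sp.
Qed.

Lemma top_component_neq0 p : p != 0 -> top_component p != 0.
Proof.
move=> p0; apply/eqP => t0; have := msize_sub_top_component p0.
by rewrite t0 subr0 ltnn.
Qed.

(** The product of the top components is the component of highest degree of the
    product. Arbitrary factors of a homogeneous polynomial may thus be traded
    for homogeneous ones. *)
Lemma homogM_top_component d p q :
  p * q != 0 -> p * q \is d.-homog ->
  p * q = top_component p * top_component q /\ d = ((msize p).-1 + (msize q).-1)%N.
Proof.
rewrite mulf_eq0 negb_or => /andP[p0 q0] hpq.
have [sp sq] : (0 < msize p)%N /\ (0 < msize q)%N.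
  by rewrite !lt0n !msize_poly_eq0.
have dE : d = ((msize p).-1 + (msize q).-1)%N.
  have := dhomog_msize hpq; rewrite /= => hpq'.
  rewrite (dhomog_uniq _ hpq hpq') ?mulf_neq0 // msizeM //.
  by rewrite -(prednK sp) -(prednK sq) addSn addnS.
split=> //; apply/eqP; rewrite -subr_eq0; apply/eqP.
set P := top_component p; set Q := top_component q.
(* The left form is homogeneous of degree d, the right one has size at most d. *)
have -> : p * q - P * Q = (p - P) * q + P * (q - Q) by ring.
apply: (@homog_eq0 d).
  have -> : (p - P) * q + P * (q - Q) = p * q - P * Q by ring.
  by rewrite rpredB // dE dhomogM // top_component_homog.
have leM (a b : {mpoly K[n]}) : (msize a + msize b <= d.+1)%N -> (msize (a * b)%R <= d)%N.
  move=> ab; have [->|a0] := eqVneq a 0; first by rewrite mul0r msize0.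
  have [->|b0] := eqVneq b 0; first by rewrite mulr0 msize0.
  by rewrite msizeM // -subn1 leq_subLR add1n.
have d2 : d.+2 = (msize p + msize q)%N.
  by rewrite dE -{2}(prednK sp) -{2}(prednK sq) addSn addnS.
apply: leq_trans (msizeD_le _ _) _; rewrite geq_max; apply/andP; split; apply: leM.
  by rewrite -ltnS d2 ltn_add2r msize_sub_top_component.
rewrite -ltnS d2 -addnS leq_add ?msize_sub_top_component //.
rewrite msizeE; apply/bigmax_leqP_seq => m mP _.
by rewrite (dhomog_mf (top_component_homog p) mP) prednK.
Qed.

End TopComponent.

(** Simplifying a fraction a / b = (d a) / (d b) does not change whether a
    derivation kills it. *)
Lemma derivation_ratio_scale (A : idomainType) (d a b d' a' b' : A) : d != 0 ->
  (d' * a + d * a') * (d * b) = d * a * (d' * b + d * b') -> a' * b = a * b'.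
Proof.
move=> d0 E; apply: (mulfI (mulf_neq0 d0 d0)).
apply: (addrI (d' * a * (d * b))).
transitivity ((d' * a + d * a') * (d * b)); first by ring.
by rewrite E; ring.
Qed.

(** Lowest terms, by induction on the degree: a common factor D that is not a
    unit has positive degree, and dividing by the top component of D lowers the
    common degree of p and q. *)
Lemma coprime_first_integral (R : realType) (X : vfield R) e (p q : polyC3 R) :
  p \is e.-homog -> q \is e.-homog -> q != 0 -> ~ proportional p q ->
  vf_poly X p * q = p * vf_poly X q ->
  exists2 e', (e' <= e)%N & rat_first_integral X e'.
Proof.
elim/ltn_ind: e p q => e IH p q hp hq q0 npq Dpq.
have [pq|] := pselect (mcoprime p q).
  exists e => //; exists p, q; split => //.
    move=> [c E]; apply: npq; exists c; apply/eqP.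
    by rewrite -tofrac_eq tofracM -E divfK // tofrac_eq0.
  by rewrite vf_rat_div // Dpq subrr tofrac0 mul0r.
have p0 : p != 0.
  by apply/eqP => p0; apply: npq; exists 0; rewrite mpolyC0 mul0r.
move=> /existsNP[D] /existsNP[A] /existsNP[B] /not_implyP[pE].
move=> /not_implyP[qE] Du.
have := homogM_top_component (p := D) (q := A); rewrite -pE => /(_ e p0 hp)[pE' eA].
have := homogM_top_component (p := D) (q := B); rewrite -qE => /(_ e q0 hq)[qE' eB].
have D0 : D != 0 by apply: contra_neq p0 => D0; rewrite pE D0 mul0r.
have B0 : B != 0 by apply: contra_neq q0 => B0; rewrite qE B0 mulr0.
have sD : (1 < msize D)%N.
  rewrite ltnNge; apply/negP => sD; apply: Du.
  have DE := msize1_polyC sD.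
  rewrite unfold_in /= /mpoly_unit -DE eqxx /= unitfE; apply: contra_neq D0.
  by move=> z; rewrite DE z.
have sE : (msize A).-1 = (msize B).-1 by apply/eqP; rewrite -(eqn_add2l (msize D).-1) -eA -eB.
have lt : ((msize A).-1 < e)%N.
  by rewrite eA -addn1 addnC leq_add2r -ltnS prednK // ltnW.
set D' := top_component D in pE' qE'; set A' := top_component A in pE'.
set B' := top_component B in qE'.
have D'0 : D' != 0 by exact: top_component_neq0.
have [||||e' le' int] := IH _ lt A' B' (top_component_homog A).
- by rewrite sE top_component_homog.
- exact: top_component_neq0.
- by move=> [c E]; apply: npq; exists c; rewrite pE' qE' E mulrCA.
- apply: (derivation_ratio_scale (d := D') (d' := vf_poly X D') D'0).
  by rewrite -!vf_polyM -pE' -qE'.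
- by exists e' => //; apply: leq_trans le' (ltnW lt).
Qed.

(** * Pencils of vector fields and points of the space of foliations *)

Lemma pencil_difference (K : nzRingType) (V : lmodType K) (x y : V) (a b c : K) :
  x + b *: y - a *: (x + c *: y) = (1 - a) *: x + (b - a * c) *: y.
Proof.
by rewrite scalerDr scalerA opprD addrACA !scalerBl scale1r.
Qed.

(** Adding to a derivation one that multiplies p and q by the same g does not
    change whether it kills p / q. For a multiple of the radial field, this
    holds by Euler's identity when p and q have the same degree. *)
Lemma derivation_ratio_shift (A : idomainType) (c g p q p' q' : A) : c != 0 ->
  (c * p' + g * p) * q = p * (c * q' + g * q) -> p' * q = p * q'.
Proof.
move=> c0 E; apply: (mulfI c0); apply: (addIr (g * p * q)).
transitivity ((c * p' + g * p) * q); first by ring.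
by rewrite E; ring.
Qed.

Section Pencil.

Variable R : realType.
Implicit Types (X Y Z : vfield R) (p q : polyC3 R) (c : complex R).

Lemma vf_poly_horner X (p : {poly polyC3 R}) c :
  vf_poly X p.[c%:MP] = (map_poly (vf_poly X) p).[c%:MP].
Proof.
rewrite (horner_coef_wide _ (size_poly _ _)) horner_coef vf_poly_sum.
apply: eq_bigr => i _; rewrite coef_map_id0 ?(vf_polyC X 0) // vf_polyM.
by rewrite -rmorphXn vf_polyC mulr0 addr0.
Qed.

Definition vf_pencil X Y c : vfield R := X + c%:MP *: Y.

Lemma vf_pencil_homog k X Y c :
  vf_homog k X -> vf_homog k Y -> vf_homog k (vf_pencil X Y c).
Proof.
move=> hX hY i; rewrite !mxE mul_mpolyC.
by apply: dhomogD; [exact: hX | apply: dhomogZ; exact: hY].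
Qed.

(** The derivation X + cY acts on polynomials in c, whose coefficients it
    differentiates: each application raises the degree in c by one. *)
Lemma iter_vf_pencil_horner X Y (f : polyC3 R) i :
  exists2 p : {poly polyC3 R}, (size p <= i.+1)%N &
    forall c, iter i (vf_poly (vf_pencil X Y c)) f = p.[c%:MP].
Proof.
elim: i => [|i [p sp IH]].
  by exists f%:P => [|c]; rewrite ?size_polyC_leq1 ?hornerC.
exists (map_poly (vf_poly X) p + map_poly (vf_poly Y) p * 'X) => [|c].
  rewrite (leq_trans (size_polyD _ _)) // geq_max.
  have smap Z : (size (map_poly (vf_poly Z) p) <= i.+1)%N.
    exact: leq_trans (size_poly _ _) sp.
  rewrite (leq_trans (smap X)) //=.
  by rewrite (leq_trans (size_polyMleq _ _)) // size_polyX addn2 ltnS smap.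
rewrite iterS IH /vf_pencil vf_polyDl vf_polyZl !vf_poly_horner.
by rewrite hornerD hornerMX [_ * c%:MP]mulrC.
Qed.

(** Row i of the matrix has entries of degree at most i in c. The size bound
    uses only that these have size at most n, which costs no more than a
    constant factor. *)
Lemma wronskian_pencil_horner X Y (v : nat -> polyC3 R) n : (0 < n)%N ->
  exists2 W : {poly polyC3 R}, (size W <= n ^ 2)%N &
    forall c, wronskian (vf_poly (vf_pencil X Y c)) v n = W.[c%:MP].
Proof.
move=> n0.
have /choice [f fP] : forall ij : 'I_n * 'I_n, exists p : {poly polyC3 R},
    (size p <= n)%N /\
    forall c, iter ij.1 (vf_poly (vf_pencil X Y c)) (v ij.2) = p.[c%:MP].
  move=> [i j]; have [p sp pE] := iter_vf_pencil_horner X Y (v j) i.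
  by exists p; split=> //; apply: leq_trans sp (ltn_ord i).
exists (\det (\matrix_(i, j) f (i, j))) => [|c].
  rewrite (leq_trans (size_sum _ _ _)) //; apply/bigmax_leqP => s _.
  rewrite -signr_odd mulr_sign; set P := \prod_i _.
  have -> : size (if odd s then - P else P) = size P by case: ifP; rewrite ?size_polyN.
  rewrite {}/P.
  rewrite (leq_trans (size_prod_leq _ _)) // leq_subLR card_ord -addn1 addnC.
  apply: leq_add => //; rewrite -mulnn -[X in (_ <= X * _)%N]card_ord.
  by rewrite -sum_nat_const; apply: leq_sum => i _; rewrite mxE; have [] := fP (i, s i).
rewrite /wronskian -[RHS]/(horner_eval _ _) -det_map_mx; congr (\det _).
by apply/matrixP => i j; rewrite !mxE /horner_eval; have [_ ->] := fP (i, j).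
Qed.

Lemma radial_multipleZ X (g : polyC3 R) : radial_multiple X -> radial_multiple (g *: X).
Proof. by move=> [h ->]; exists (g * h); rewrite scalerA. Qed.

Lemma radial_multiple_unscale X c :
  c != 0 -> radial_multiple (c%:MP *: X) -> radial_multiple X.
Proof.
move=> c0 /(radial_multipleZ (c^-1)%:MP).
by rewrite scalerA -mpolyCM (mulVf c0) mpolyC1 scale1r.
Qed.

Lemma radial_multipleD X Y :
  radial_multiple X -> radial_multiple Y -> radial_multiple (X + Y).
Proof. by move=> [g ->] [h ->]; exists (g + h); rewrite scalerDl. Qed.

Lemma mem_fol_class k X : vf_homog k X -> fol_class k X X.
Proof.
move=> hX; split=> //; exists 1; split; first exact: oner_neq0.
by rewrite scale1r subrr; exists 0; rewrite scale0r.
Qed.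

Lemma eq_fol_class k X Z c : c != 0 ->
  radial_multiple (Z - c%:MP *: X) -> fol_class k Z = fol_class k X.
Proof.
move=> c0 rZX; apply/seteqP; split=> W [hW [a [a0 rW]]]; split=> //.
  exists (a * c); split; first exact: mulf_neq0.
  rewrite (_ : W - _ = (W - a%:MP *: Z) + a%:MP *: (Z - c%:MP *: X)).
    by apply: radial_multipleD => //; exact: radial_multipleZ.
  by rewrite scalerBr scalerA mpolyCM addrA subrK.
exists (a / c); split; first by rewrite mulf_neq0 ?invr_neq0.
rewrite (_ : W - _ = (W - a%:MP *: X) + (- (a / c)%:MP) *: (Z - c%:MP *: X)).
  by apply: radial_multipleD => //; exact: radial_multipleZ.
rewrite scalerBr scalerA mulNr -mpolyCM divfK // !scaleNr opprK.
by rewrite addrACA [_ + _ *: X]addrC subrr addr0.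
Qed.

Lemma Fol_not_radial k X : vf_homog k X -> Fol k (fol_class k X) -> ~ radial_multiple X.
Proof.
move=> hX [X' [hX' nr E]] rX; apply: nr.
have := mem_fol_class hX'; rewrite -E => -[_ [c [_ r]]].
by rewrite -(subrK (c%:MP *: X) X'); apply: radial_multipleD => //; exact: radial_multipleZ.
Qed.

(** A coincidence of two members of the pencil is a relation u X + w Y = 0 up to
    multiples of the radial field with (u, w) <> 0, whereas X and Y represent
    distinct points. *)
Lemma fol_class_pencil_inj k X Y :
  vf_homog k X -> vf_homog k Y ->
  Fol k (fol_class k X) -> Fol k (fol_class k Y) ->
  fol_class k X <> fol_class k Y ->
  injective (fun c => fol_class k (vf_pencil X Y c)).
Proof.
move=> hX hY /(Fol_not_radial hX) nX /(Fol_not_radial hY) nY nXY b c /= E.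
apply: contrapT => bc.
have := mem_fol_class (vf_pencil_homog b hX hY); rewrite E => -[_ [a [a0 r]]].
have {}r : radial_multiple ((1 - a)%:MP *: X + (b - a * c)%:MP *: Y).
  by rewrite !mpolyCB mpolyCM mpolyC1 -pencil_difference.
have [a1|a1] := eqVneq a 1.
  move: r; rewrite a1 subrr mpolyC0 scale0r add0r mul1r.
  move=> r; apply: nY; apply: radial_multiple_unscale r.
  by rewrite subr_eq0; exact/eqP.
have {}a1 : 1 - a != 0 by rewrite subr_eq0 eq_sym.
have [d0|d0] := eqVneq (b - a * c) 0.
  move: r; rewrite d0 mpolyC0 scale0r addr0.
  by move/(radial_multiple_unscale a1).
apply: nXY; apply: (@eq_fol_class _ _ _ (- ((b - a * c) / (1 - a)))).
  by rewrite oppr_eq0 mulf_neq0 ?invr_neq0.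
apply: (radial_multiple_unscale a1); rewrite scalerBr scalerA -mpolyCM.
have -> : (1 - a) * - ((b - a * c) / (1 - a)) = - (b - a * c).
  by rewrite mulrN mulrC divfK.
by rewrite mpolyCN scaleNr opprK.
Qed.

Lemma rat_first_integral_pair X e : rat_first_integral X e ->
  exists p q : polyC3 R,
    [/\ p \is e.-homog /\ q \is e.-homog, q != 0, ~ proportional p q &
        vf_poly X p * q = p * vf_poly X q].
Proof.
move=> [p [q [[hp hq] [q0 _] npq Xpq]]]; exists p, q; split => //.
  move=> [c pE]; apply: npq; exists c.
  by rewrite pE tofracM mulfK // tofrac_eq0.
move: Xpq; rewrite vf_rat_div // => /eqP.
rewrite mulf_eq0 invr_eq0 !tofrac_eq0 expf_eq0 (negPf q0) andbF orbF subr_eq0.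
by move=> /eqP.
Qed.

(** The Wronskian depends on the chosen representative X of a point, but its
    vanishing detects the first integrals of all representatives Z. *)
Lemma fol_class_first_integral_wronskian_eq0 k X Z d e : (e <= d)%N ->
  fol_class k X Z -> rat_first_integral Z e ->
  wronskian (vf_poly X) (grid (complex R) d) (d.+1 ^ 2) = 0.
Proof.
move=> ed [_ [c [c0 [g ZE]]]] /rat_first_integral_pair[p [q [[hp hq] q0 npq Zpq]]].
apply: (first_integral_wronskian_eq0 ed hp hq q0 npq).
have vZ (f : polyC3 R) : f \is e.-homog ->
    vf_poly Z f = c%:MP * vf_poly X f + g * e%:R * f.
  move=> hf; rewrite -(subrK (c%:MP *: X) Z) ZE vf_polyDl !vf_polyZl.
  by rewrite (vf_poly_radial hf) mulrA addrC.
move: Zpq; rewrite !vZ //; apply: derivation_ratio_shift.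
by rewrite mpolyC_eq0.
Qed.

Lemma rat_first_integral_gt0 X e : rat_first_integral X e -> (0 < e)%N.
Proof.
move=> /rat_first_integral_pair[p [q [[hp hq] q0 npq _]]].
rewrite lt0n; apply/eqP => e0; apply: npq; rewrite {}e0 in hp hq.
have cst (f : polyC3 R) : f \is 0.-homog -> exists a, f = a%:MP.
  move=> hf; exists f@_0; apply: msize1_polyC; rewrite msizeE.
  by apply/bigmax_leqP_seq => m /(dhomog_mf hf) /= ->.
have [a pE] := cst p hp; have [b qE] := cst q hq.
exists (a / b); rewrite pE qE -mpolyCM divfK //.
by apply: contra_neq q0; rewrite qE => ->.
Qed.

End Pencil.

(** * Counting the points of the line *)

Lemma counting_lt_pinfty (T : choiceType) (R : realType) (A : set T) :
  (counting_measure.counting A < +oo :> \bar R)%E ->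
  exists s : seq T, [/\ uniq s, forall x, A x <-> x \in s &
    counting_measure.counting A = (size s)%:R%:E :> \bar R].
Proof.
rewrite /counting_measure.counting; case: ifPn => [/asboolP fA _|]; last by rewrite ltxx.
exists (fset_set A); split => // x; rewrite in_fset_set //.
by split=> [/mem_set|/set_mem].
Qed.

Lemma injective_nat_not_mem (T : eqType) (r : seq T) (f : nat -> T) :
  injective f -> ~ (forall i, f i \in r).
Proof.
move=> f_inj fr; suff : (size (map f (iota 0 (size r).+1)) <= size r)%N.
  by rewrite size_map size_iota ltnn.
by apply: uniq_leq_size => [|_ /mapP[i _ ->] //]; rewrite map_inj_uniq ?iota_uniq.
Qed.

(** The point y is set aside, as it is the one point of the line that the affine
    parameter of the pencil misses; it is paid for by the difference between the
    size and the degree of W. *)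
Lemma size_le_poly_roots (T : eqType) (A : idomainType) (W : {poly A})
    (s : seq T) (y : T) (f : T -> A) :
  W != 0 -> uniq s -> {in rem y s, forall p, root W (f p)} ->
  {in rem y s &, injective f} -> (size s <= size W)%N.
Proof.
move=> W0 s_uniq fW f_inj; apply: (@leq_trans (size (rem y s)).+1).
  have [ys|ys] := boolP (y \in s); last by rewrite rem_id.
  by rewrite size_rem // leqSpred.
rewrite -(size_map f); apply: max_poly_roots => //.
  by apply/allP => _ /mapP [p ps ->]; exact: fW.
by rewrite map_inj_in_uniq // rem_uniq.
Qed.

Lemma mpolyC_inj n (K : nzRingType) : injective (@mpolyC n K).
Proof. by move=> a b /eqP; rewrite mpolyC_eq => /eqP. Qed.

Lemma line_pencil (R : realType) k (X Y : vfield R) c :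
  exists s t : complex R, (s, t) != (0, 0) /\
    fol_class k (vf_pencil X Y c) = fol_class k (vf_lin s t X Y).
Proof.
exists 1, c; split; first by rewrite xpair_eqE oner_eq0.
by rewrite /vf_lin scale1r.
Qed.

Lemma fol_class_vf_lin (R : realType) k (X Y : vfield R) s t :
  (s, t) != (0, 0) ->
  fol_class k (vf_lin s t X Y) = fol_class k Y \/
  exists c, fol_class k (vf_lin s t X Y) = fol_class k (vf_pencil X Y c).
Proof.
move=> st; have [s0|s0] := eqVneq s 0; [left|right].
  apply: (@eq_fol_class _ _ _ _ t).
    by apply: contra_neq st => ->; rewrite s0.
  rewrite /vf_lin s0 mpolyC0 scale0r add0r subrr.
  by exists 0; rewrite scale0r.
exists (t / s); apply: (@eq_fol_class _ _ _ _ s) => //; exists 0.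
rewrite /vf_lin /vf_pencil scale0r scalerDr scalerA -mpolyCM.
have -> : s * (t / s) = t by rewrite mulrC divfK.
by rewrite subrr.
Qed.

Theorem proposition4 (R : realType) (k : nat) (C : set (set (vfield R)))
    (hC : projective_line k C)
    (hfin : forall d : nat, (pi_line C d < +oo)%E) :
  exists K : R, forall d : nat, (pi_line C d <= (K * d%:R ^+ 4)%:E)%E.
Proof.
have [X [Y [[hX hY] [fX fY] nXY CE]]] := hC.
pose pt c := fol_class k (vf_pencil X Y c).
have pt_inj : injective pt by exact: fol_class_pencil_inj.
exists 16%:R => d; have [s [s_uniq sP]] := counting_lt_pinfty (hfin d).
rewrite -/(pi_line C d) => ->.
have [d0|d_gt0] := posnP d.
  case: s s_uniq sP => [|p s] _ sP; first by rewrite lee_fin mulr_ge0 ?exprn_ge0.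
  have [_ [Z [_ [e [ed /rat_first_integral_gt0]]]]] :=
    (sP p).2 (mem_head _ _).
  by move=> e_gt0; have := leq_trans e_gt0 ed; rewrite d0.
have [W sW WE] := wronskian_pencil_horner X Y (grid (complex R) d)
  (isT : 0 < d.+1 ^ 2)%N.
have W0 : W != 0.
  apply/eqP => W0.
  (* D is the degree bound that the vanishing of the Wronskian yields. *)
  pose D := (\sum_(i < d.+1 ^ 2) iter i (fun m => (m + k).-1) d.*2)%N.
  have algpt c : algebraic_points C D (pt c).
    split; first by rewrite CE; exact: line_pencil.
    exists (vf_pencil X Y c); have hc := vf_pencil_homog c hX hY.
    split; first exact: mem_fol_class.
    have [|e [p [q [eD [hp hq] q0 npq Dpq]]]] :=
      wronskian_eq0_first_integral hc _ (leqnn _) (d := d).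
      by rewrite WE W0 horner0.
    have [e' e'e int] := coprime_first_integral hp hq q0 npq Dpq.
    by exists e'; split; [exact: leq_trans eD | exact: int].
  have [r [_ rP _]] := counting_lt_pinfty (hfin D).
  have natr_inj : injective (fun n : nat => n%:R : complex R).
    exact: (mulrIn (oner_neq0 (complex R))).
  have := @injective_nat_not_mem _ r (fun i => pt i%:R) (inj_comp pt_inj natr_inj).
  by apply=> i; apply/rP; exact: algpt.
have /choice [h hP] : forall p, exists c, p \in rem (fol_class k Y) s ->
    p = pt c /\ W.[c%:MP] = 0.
  move=> p; have [ps|] := boolP (p \in rem _ s); last by exists 0.
  move: ps; rewrite (mem_rem_uniq _ s_uniq) inE => /andP[/= pY /sP [Cp [Z [pZ]]]].
  move=> [e [ed Ze]].
  move: Cp; rewrite CE => -[a [b [ab pE]]].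
  have [pY'|[c pE']] := fol_class_vf_lin k X Y ab.
    by rewrite pE pY' eqxx in pY.
  exists c => _; split; first by rewrite pE.
  rewrite -WE; move: pZ; rewrite pE pE' => pZ.
  exact: fol_class_first_integral_wronskian_eq0 ed pZ Ze.
have size_s : (size s <= (d.+1 ^ 2) ^ 2)%N.
  apply: leq_trans sW.
  apply: (size_le_poly_roots (y := fol_class k Y) (f := fun p => (h p)%:MP) W0 s_uniq).
    by move=> p /hP [_ Wp]; apply/rootP.
  by move=> p q /hP [pE _] /hP [qE _] /mpolyC_inj hpq; rewrite pE hpq -qE.
rewrite lee_fin -natrX -natrM ler_nat; apply: leq_trans size_s _.
have -> : (16 * d ^ 4 = (2 * d) ^ 4)%N by rewrite expnMn.
rewrite -expnM leq_exp2r // mul2n -addnn -addn1.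
by rewrite leq_add2l.
Qed.
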